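(* Let $E$ be a Banach space, let $F$ be a bounded subset of $E$ with $F \subseteq B(0,R)$, and let $x \in E$. (1) Assume that $x \in \operatorname{co}(F)$ and let $F_0 \subseteq F$ be any finite set such that $x \in \operatorname{co}(F_0)$. Then there is a sequence $(x_n)_{n\ge1}$ of elements of $F_0$ and a positive constant $C = C(|F_0|)$, depending only on the cardinality $|F_0|$, such that $$\left\| \frac{1}{N} \sum_{k=1}^N x_k - x \right\| \le \frac{2R}{N}(1 + C) \quad \text{for all } N \ge 1;$$ in particular $\frac{1}{N}\sum_{k=1}^N x_k \to x$ in norm as $N \to \infty$. (2) Assume that $x \in \overline{\operatorname{co}}(F)$. Then there is a sequence $(x_n)_{n\ge1}$ of elements of $F$ such that $\frac{1}{N}\sum_{k=1}^N x_k \to x$ in norm as $N \to \infty$.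
   Context: Banach spaces are real. $B(0,R)$ denotes the closed ball of radius $R>0$ centred at $0$ in $E$. $\operatorname{co}(A)$ is the convex hull of $A$ and $\overline{\operatorname{co}}(A)$ is the norm closure of $\operatorname{co}(A)$. *)

(* Defs.v *)
From mathcomp Require Import all_boot all_order all_algebra finmap.
From mathcomp Require Import all_classical all_reals all_analysis.
Set Implicit Arguments.
Unset Strict Implicit.
Unset Printing Implicit Defensive.
Import Order.TTheory GRing.Theory Num.Theory.
Import numFieldNormedType.Exports.
Local Open Scope classical_set_scope.
Local Open Scope ring_scope.

Definition convex_hull (R : numDomainType) (M : lmodType R) (A : set M) :
  set M := smallest (@convex_set R M) A.

(* The average (x_1 + ... + x_N) / N of a sequence indexed from 1: the value
   u 0 is not used. *)
Definition average (R : numFieldType) (M : lmodType R) (u : nat -> M)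
  (N : nat) : M := N%:R^-1 *: \sum_(1 <= k < N.+1) u k.

(* Main.v *)
Require Import Defs.
From mathcomp Require Import all_boot all_order all_algebra finmap.
From mathcomp Require Import all_classical all_reals all_analysis.
From mathcomp Require Import lra.
Import Order.TTheory GRing.Theory Num.Theory.
Import numFieldNormedType.Exports.
Local Open Scope classical_set_scope.
Local Open Scope ring_scope.
Set Implicit Arguments.
Unset Strict Implicit.
Unset Printing Implicit Defensive.

(** The sequence comes from a greedy apportionment. Write [x] as a convex
combination of the points of a finite set [S] included in the ball of radius
[r], with weights [w y]. At each time
every point [y] earns a credit [w y], and the point chosen at that time pays
[1]; always choose a point whose credit is positive after the earnings. One
exists, because the credits of the points of [S] sum to [0] before the earnings
and to [1] after them. Hence no credit ever falls below [-1]; as they sum to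
[0], the absolute values of the credits sum to at most twice the cardinal of
[S]. The credit of [y] after [N] steps is [N * w y] minus the number of times
that [y] was chosen, so the sum of the first [N] chosen points differs from
[N *: x] by at most [2 * r * #|S|], whatever [N] is. This is the first part,
and it shows that [C m = m + 1] is a possible constant.

The argument is unchanged when the weights vary with time on a growing support
([greedy_allocation], [greedy_sum]): a point that enters later starts with
credit [0]. For [x] in the closure of the hull, choose points [z n] of the hull
that converge to [x], let [S n] contain the supports of [z 0], ..., [z n], and
at time [k] use the weights of [z (m k)], where [m] tends to infinity so slowly
that the cardinal of [S (m N)] is negligible with respect to [N]
([slow_growth]). The chosen points then have the same asymptotic averages as
the [z (m k)] ([cvg_average]), and these converge to [x] by Cesaro's lemma. *)

(** * Finitely supported weights and barycenters *)

(** Weights are functions on the whole type that vanish outside [S], so that the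
support can be enlarged without changing them. *)
Definition prob_on (R : realType) (T : choiceType) (S : {fset T})
    (w : T -> R) : Prop :=
  [/\ forall y, 0 <= w y, forall y, y \notin S -> w y = 0
    & \sum_(y <- S) w y = 1].

Definition barycenter (R : realType) (E : lmodType R) (S : {fset E})
  (w : E -> R) : E := \sum_(y <- S) w y *: y.

Lemma prob_on_widen (R : realType) (T : choiceType) (S S' : {fset T})
    (w : T -> R) : (S `<=` S')%fset -> prob_on S w -> prob_on S' w.
Proof.
move=> SS' [w0 wS w1]; split=> // [y yS'|].
  by apply: wS; apply: contra yS'; apply: (fsubsetP SS').
by rewrite -(big_fset_incl _ SS')// => y _ /wS.
Qed.

Lemma barycenter_widen (R : realType) (E : lmodType R) (S S' : {fset E})
    (w : E -> R) : (S `<=` S')%fset -> prob_on S w ->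
  barycenter S' w = barycenter S w.
Proof.
move=> SS' [_ wS _]; rewrite /barycenter -(big_fset_incl _ SS')// => y _ /wS ->.
exact: scale0r.
Qed.

(** Barycenters of finite subsets of [A] form a convex set containing [A]: to
combine two of them, put both families of weights on the union of the supports.
*)
Lemma convex_hull_barycenter (R : realType) (E : lmodType R) (A : set E)
    (x : E) : convex_hull A x ->
  exists S : {fset E}, exists w : E -> R,
    [/\ [set` S] `<=` A, prob_on S w & barycenter S w = x].
Proof.
move: x; apply: smallest_sub => [x y l|x Ax].
  rewrite !inE => -[S [w [SA wS <-]]] [S' [w' [SA' wS' <-]]].
  have [sl sr] := (fsubsetUl S S', fsubsetUr S S').
  rewrite -(barycenter_widen sl wS) -(barycenter_widen sr wS').
  have [w0 wN w1] := prob_on_widen sl wS.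
  have [w0' wN' w1'] := prob_on_widen sr wS'.
  exists (S `|` S')%fset, (fun z => l%:num * w z + (1 - l%:num) * w' z).
  split.
  - by move=> z /=; rewrite inE => /orP[/SA|/SA'].
  - split=> [z|z zN|].
    + by rewrite addr_ge0// mulr_ge0// subr_ge0.
    + by rewrite wN// wN'// !mulr0 addr0.
    + by rewrite big_split/= -!mulr_sumr w1 w1' !mulr1 addrC subrK.
  - rewrite /barycenter.
    under eq_bigr do rewrite scalerDl -!scalerA.
    by rewrite big_split/= -!scaler_sumr.
exists [fset x]%fset, (fun z => (z == x)%:R); split.
- by move=> z /=; rewrite inE => /eqP ->.
- split=> [z|z|]; first exact: ler0n.
    by rewrite inE => /negPf ->.
  by rewrite big_seq_fset1 eqxx.
- by rewrite /barycenter big_seq_fset1 eqxx scale1r.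
Qed.

(** * The greedy apportionment *)

Lemma exists_gt0_of_sum_gt0 (R : realType) (T : choiceType) (S : {fset T})
    (b : T -> R) : 0 < \sum_(y <- S) b y -> exists2 y, y \in S & 0 < b y.
Proof.
move=> b0; apply: contrapT => nb; move: b0; apply/negP; rewrite -leNgt.
rewrite big_seq; apply: sumr_le0 => y yS; rewrite leNgt; apply/negP => by0.
by apply: nb; exists y.
Qed.

(** At each time a total weight [1] is earned and [1] is paid. Monotonicity of
the supports ensures that all the points involved up to time [N] are in [S N].
*)
Lemma balance_sum0 (R : realType) (T : choiceType) (S : nat -> {fset T})
    (w : nat -> T -> R) (c : nat -> T) N :
  {homo S : m n / (m <= n)%N >-> (m `<=` n)%fset} ->
  (forall n, prob_on (S n) (w n)) -> (forall n, c n \in S n) ->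
  \sum_(y <- S N) \sum_(0 <= k < N) (w k y - (c k == y)%:R) = 0.
Proof.
move=> Smono wS cS; rewrite exchange_big/= big_nat big1// => k /andP[_ kN].
have SkN := Smono _ _ (ltnW kN); have [_ _ wk1] := prob_on_widen SkN (wS k).
rewrite big_split/= wk1 sumrN (big_fsetD1 (c k)) ?(fsubsetP SkN)//= eqxx.
rewrite big_seq big1 ?addr0 ?subrr// => y.
by rewrite !inE eq_sym => /andP[/negPf -> _].
Qed.

(** The inner sum is the credit of [y] after [N] steps. Choosing at each step a
point of positive credit, the payment of [1] cannot bring it below [-1]; the
other credits do not decrease. *)
Lemma greedy_allocation (R : realType) (T : choiceType) (S : nat -> {fset T})
    (w : nat -> T -> R) :
  {homo S : m n / (m <= n)%N >-> (m `<=` n)%fset} ->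
  (forall n, prob_on (S n) (w n)) ->
  exists c : nat -> T, (forall n, c n \in S n) /\
    forall N y, -1 <= \sum_(0 <= k < N) (w k y - (c k == y)%:R).
Proof.
move=> Smono wS.
(* The second clause is conditional so that the choice is total: positivity of
   the sum depends on the previous choices. *)
have /choice[pick pickP] (p : nat * (T -> R)) : exists y, y \in S p.1 /\
    (0 < \sum_(z <- S p.1) (p.2 z + w p.1 z) -> 0 < p.2 y + w p.1 y).
  case: p => n b /=; have [|le0] := boolP (0 < \sum_(z <- S n) (b z + w n z)).
    by move=> /exists_gt0_of_sum_gt0[y yS y0]; exists y.
  have [_ _ w1] := wS n.
  have [|y yS _] := @exists_gt0_of_sum_gt0 _ _ (S n) (w n); first by rewrite w1.
  by exists y.
pose bal n := iteri n (fun k b y => b y + (w k y - (pick (k, b) == y)%:R))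
  (fun=> 0 : R).
pose c n := pick (n, bal n).
have cS n : c n \in S n by have [] := pickP (n, bal n).
have balS n y : bal n.+1 y = bal n y + (w n y - (c n == y)%:R) by [].
have balE n y : bal n y = \sum_(0 <= k < n) (w k y - (c k == y)%:R).
  elim: n => [|n IH]; first by rewrite big_geq.
  by rewrite balS big_nat_recr//= IH.
exists c; split=> // N y; rewrite -[X in _ <= X]balE.
elim: N => [|n IH]; first by rewrite /bal /= oppr_le0.
have [w0 _ w1] := wS n; have [_ pos] := pickP (n, bal n).
have /pos/= c0 : 0 < \sum_(z <- S n) (bal n z + w n z).
  rewrite big_split/= w1; under eq_bigr do rewrite balE.
  by rewrite balance_sum0// add0r.
rewrite addrA; have [<-|_] := eqVneq; first by rewrite lerBrDr addNr ltW.
by rewrite subr0 ler_wpDr.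
Qed.

(** Reals [b y >= -1] satisfy [`|b y| <= b y + 2]. If they sum to [0], their
absolute values thus sum to at most twice their number. Up to sign, the credits
are the coefficients of the difference between the two vector sums. *)
Lemma greedy_sum (R : realType) (E : normedModType R) (r : R)
    (S : nat -> {fset E}) (w : nat -> E -> R) :
  {homo S : m n / (m <= n)%N >-> (m `<=` n)%fset} ->
  (forall n, prob_on (S n) (w n)) ->
  (forall n y, y \in S n -> `|y| <= r) ->
  exists c : nat -> E, (forall n, c n \in S n) /\
    forall N, `|\sum_(0 <= k < N) (c k - barycenter (S k) (w k))|
      <= 2 * r * #|` S N|%:R.
Proof.
move=> Smono wS Sr; have [c [cS cN]] := greedy_allocation Smono wS.
exists c; split=> // N.
pose b y : R := \sum_(0 <= k < N) (w k y - (c k == y)%:R).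
have ->: \sum_(0 <= k < N) (c k - barycenter (S k) (w k)) =
    - \sum_(y <- S N) b y *: y.
  rewrite /b; under [in RHS]eq_bigr do rewrite scaler_suml.
  rewrite exchange_big -sumrN/= !big_nat; apply: eq_bigr => k /andP[_ kN].
  have SkN := Smono _ _ (ltnW kN).
  under [in RHS]eq_bigr do rewrite scalerBl.
  rewrite big_split/= -/(barycenter (S N) (w k)) (barycenter_widen SkN)//.
  rewrite sumrN opprD opprK addrC; congr (_ + _).
  rewrite (big_fsetD1 (c k)) ?(fsubsetP SkN)//= eqxx scale1r.
  rewrite big_seq big1 ?addr0// => y.
  by rewrite !inE eq_sym => /andP[/negPf -> _]; rewrite scale0r.
have sumb : \sum_(y <- S N) b y = 0 by exact: balance_sum0.
rewrite normrN (le_trans (ler_norm_sum _ _ _))//.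
have -> : 2 * r * #|` S N|%:R = \sum_(y <- S N) (b y + 2) * r.
  rewrite -mulr_suml big_split/= sumb add0r big_const_seq count_predT.
  by rewrite iter_addr_0 -(mulr_natr 2) [RHS]mulrAC.
rewrite !big_seq; apply: ler_sum => y yS; rewrite normrZ ler_pM ?(Sr N)//.
have := cN N y; rewrite -/(b y) => by1.
by rewrite ler_norml lerDl ler0n andbT opprD -lerBrDl; lra.
Qed.

(** * Convergence of averages *)

(** [m N] is the largest [i <= N] such that [i * d i <= N]; such an [i] exists,
since [0] is one. The factor [i] makes [d (m N)] not only bounded by [N] but
negligible: [d (m N) / N <= 1 / m N] as soon as [m N > 0]. *)
Lemma slow_growth (d : nat -> nat) : exists m : nat -> nat,
  [/\ {homo m : i j / (i <= j)%N},
      forall N, (m N * d (m N) <= N)%N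
    & m N @[N --> \oo] --> \oo].
Proof.
pose m N := \max_(i < N.+1 | (i * d i <= N)%N) i.
have le_m N i : (i <= N)%N -> (i * d i <= N)%N -> (i <= m N)%N.
  move=> iN di; have iN1 : (i < N.+1)%N by [].
  exact: (leq_bigmax_cond (Ordinal iN1)).
have m_ok N : (m N <= N)%N /\ (m N * d (m N) <= N)%N.
  rewrite /m; have [|i di ->] := eq_bigmax_cond (fun i : 'I_N.+1 => i : nat)
    (A := [pred i : 'I_N.+1 | (i * d i <= N)%N]).
    by apply/card_gt0P; exists ord0.
  by split; first rewrite -ltnS.
exists m; split=> [i j ij|N|].
- by have [? ?] := m_ok i; apply: le_m; apply: leq_trans ij.
- by have [] := m_ok N.
- apply/cvgnyPge => M; exists (maxn M (M * d M))%N => // N /=.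
  rewrite ssrnat.geq_max => /andP[? ?].
  exact: le_m.
Qed.

(** The shift by [predn] passes from sequences indexed from [0] to the indexing
from [1] of [average]. *)
Lemma averageB (R : realType) (E : lmodType R) (c : nat -> E) (x : E) N :
  (0 < N)%N -> average (c \o predn) N - x =
  N%:R^-1 *: \sum_(0 <= k < N) (c k - x).
Proof.
move=> N0; rewrite /average big_add1/= big_split/= scalerDr; congr (_ + _).
rewrite sumr_const_nat subn0 -scalerMnr scalerMnl -mulr_natr mulVf.
  by rewrite scale1r.
by rewrite pnatr_eq0 -lt0n.
Qed.

(** The difference of the two averages is at most [b N / N], and the averages of
[z] converge by Cesaro's lemma applied to the distances [`|z k - x|]. *)
Lemma cvg_average (R : realType) (E : normedModType R) (c z : nat -> E)
    (x : E) (b : nat -> R) :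
  (forall N, `|\sum_(0 <= k < N) (c k - z k)| <= b N) ->
  N%:R^-1 * b N @[N --> \oo] --> (0 : R) -> z k @[k --> \oo] --> x ->
  average (c \o predn) N @[N --> \oo] --> x.
Proof.
move=> cz b0 zx; pose e k := `|z k - x|.
have e0 : e k @[k --> \oo] --> (0 : R).
  by rewrite -(normr0 E); apply: cvg_norm; apply/subr_cvg0.
have mean0 : N%:R^-1 * \sum_(0 <= k < N) e k @[N --> \oo] --> (0 : R).
  by rewrite -cvg_shiftS; exact: cesaro e0.
apply/subr_cvg0; apply: norm_cvg0.
have sum0 : N%:R^-1 * b N + N%:R^-1 * \sum_(0 <= k < N) e k
    @[N --> \oo] --> (0 : R).
  by rewrite -[X in _ --> X]addr0; apply: cvgD b0 mean0.
apply: (squeeze_cvgr (f := cst 0)); [|exact: cvg_cst|exact: sum0]; near=> N.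
have N0 : (0 < N)%N by near: N; exact: nbhs_infty_gt.
rewrite normr_ge0 averageB// normrZ ger0_norm ?invr_ge0 ?ler0n//= -mulrDr.
rewrite ler_wpM2l ?invr_ge0 ?ler0n//.
under eq_bigr => k _ do rewrite -(subrKA (z k)).
rewrite big_split/=; apply: le_trans (ler_normD _ _) _.
by apply: lerD => //; exact: ler_norm_sum.
Unshelve. all: by end_near. Qed.

(** * Points of the convex hull and of its closure *)

Lemma norm_le_of_sub_ball (R : realType) (E : normedModType R) (F : set E)
    (r : R) y : 0 < r -> F `<=` closed_ball (0 : E) r -> F y -> `|y| <= r.
Proof.
move=> r0 Fr /Fr; rewrite closed_ballE// /closed_ball_ /=.
by rewrite sub0r normrN.
Qed.

Lemma convex_hull_greedy_sum (R : realType) (E : normedModType R) (r : R)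
    (x : E) (S : {fset E}) :
  {in S, forall y, `|y| <= r} -> convex_hull [set` S] x ->
  exists c : nat -> E, (forall n, c n \in S) /\
    forall N, `|\sum_(0 <= k < N) (c k - x)| <= 2 * r * #|` S|%:R.
Proof.
move=> Sr /convex_hull_barycenter[S' [w [S'S wS' <-]]].
have {}S'S : (S' `<=` S)%fset by apply/fsubsetP.
have wS := prob_on_widen S'S wS'; rewrite -(barycenter_widen S'S wS').
by apply: (@greedy_sum _ _ r (fun=> S) (fun=> w)) => // _; exact: Sr.
Qed.

(** The approximations of [x] by points of the hull are followed at the speed
given by [slow_growth] applied to the cardinals of the accumulated supports. *)
Lemma cvg_average_closure (R : realType) (E : normedModType R) (F : set E)
    (r : R) (x : E) :
  (forall y, F y -> `|y| <= r) -> closure (convex_hull F) x ->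
  exists c : nat -> E, (forall n, F (c n)) /\
    (average (c \o predn) N @[N --> \oo] --> x).
Proof.
move=> Fr clx.
have /choice[Sw SwP] (n : nat) : exists Sw : {fset E} * (E -> R),
    [/\ [set` Sw.1] `<=` F, prob_on Sw.1 Sw.2
      & `|barycenter Sw.1 Sw.2 - x| < n.+1%:R^-1].
  have n0 : 0 < n.+1%:R^-1 :> R by rewrite invr_gt0.
  have [z [/convex_hull_barycenter[S [w [SF wS <-]]]]] :=
    clx _ (nbhsx_ballx x _ n0).
  by rewrite -ball_normE /= distrC => zx; exists (S, w).
pose S n := (\bigcup_(i <- iota 0 n.+1) (Sw i).1)%fset.
have SwS n : ((Sw n).1 `<=` S n)%fset.
  by apply: bigfcup_sup; rewrite // mem_iota leq0n add0n ltnSn.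
have Smono : {homo S : m n / (m <= n)%N >-> (m `<=` n)%fset}.
  move=> m n mn; apply/bigfcupsP => i; rewrite mem_iota => /andP[_ im] _.
  by apply: bigfcup_sup; rewrite // mem_iota (leq_trans im).
have SF n y : y \in S n -> F y.
  by move=> /bigfcupP[i _ yi]; have [+ _ _] := SwP i; apply.
have [m [m_mono m_slow m_oo]] := slow_growth (fun n => #|` S n|%fset).
have [|||c [cS cN]] := @greedy_sum R E r (S \o m) (fun n => (Sw (m n)).2).
- by move=> i j ij; apply/Smono/m_mono.
- by move=> n; have [_ wS _] := SwP (m n); apply: prob_on_widen wS.
- by move=> n y /SF/Fr.
exists c; split=> [n|]; first exact: SF (cS n).
apply: (cvg_average cN).
- have inv_m : (m N)%:R^-1 @[N --> \oo] --> (0 : R).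
    apply: (cvg_comp m (fun n => n%:R^-1 : R) m_oo).
    by rewrite -cvg_shiftS; exact: cvg_harmonic.
  have dens : N%:R^-1 * #|` S (m N)|%:R @[N --> \oo] --> (0 : R).
    apply: (squeeze_cvgr (f := cst 0)); [|exact: cvg_cst|exact: inv_m].
    near=> N; have N0 : (0 < N)%N by near: N; exact: nbhs_infty_gt.
    have m0 : (0 < m N)%N by near: N; move/cvgnyPgt : m_oo; exact.
    rewrite mulr_ge0 ?invr_ge0//= ler_pdivrMl ?ltr0n//.
    by rewrite ler_pdivlMr ?ltr0n// -natrM ler_nat mulnC m_slow.
  under eq_fun do rewrite mulrCA /=.
  by rewrite -(mulr0 (2 * r)); apply: cvgM dens; exact: cvg_cst.
- apply/subr_cvg0; apply: norm_cvg0.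
  have harm : harmonic (m k) @[k --> \oo] --> (0 : R).
    exact: (cvg_comp m (@harmonic R) m_oo cvg_harmonic).
  apply: (squeeze_cvgr (f := cst 0)); [|exact: cvg_cst|exact: harm].
  apply: nearW => k; have [_ wS /ltW] := SwP (m k).
  by rewrite -(barycenter_widen (SwS (m k)) wS) normr_ge0.
Unshelve. all: by end_near. Qed.


Theorem theorem2 (R : realType) :
  (exists C : nat -> R,
    (forall m : nat, 0 < C m) /\
    forall (E : completeNormedModType R) (F : set E) (r : R) (x : E),
      bounded_set F -> 0 < r -> F `<=` closed_ball (0 : E) r ->
      convex_hull F x ->
      forall F0 : {fset E},
        [set` F0] `<=` F -> convex_hull [set` F0] x ->
        exists u : nat -> E,
          (forall n : nat, (1 <= n)%N -> u n \in F0) /\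
          (forall N : nat, (1 <= N)%N ->
            `|average u N - x| <= 2 * r / N%:R * (1 + C #|` F0|%fset)) /\
          (average u N @[N --> \oo] --> x)) /\
  (forall (E : completeNormedModType R) (F : set E) (r : R) (x : E),
    bounded_set F -> 0 < r -> F `<=` closed_ball (0 : E) r ->
    closure (convex_hull F) x ->
    exists u : nat -> E,
      (forall n : nat, (1 <= n)%N -> F (u n)) /\
      (average u N @[N --> \oo] --> x)).
Proof.
split.
- exists (fun m => m.+1%:R); split=> [m|E F r x _ r0 Fr _ F0 F0F hx].
    by rewrite ltr0n.
  have F0r : {in F0, forall y, `|y| <= r}.
    by move=> y /F0F; exact: norm_le_of_sub_ball Fr.
  have [c [cF0 cN]] := convex_hull_greedy_sum F0r hx.
  exists (c \o predn); split=> [n _|]; first exact: cF0.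
  split=> [N N1|].
    rewrite averageB// normrZ ger0_norm ?invr_ge0// (mulrC (2 * r)) -mulrA.
    rewrite ler_wpM2l ?invr_ge0// (le_trans (cN N))//.
    rewrite ler_wpM2l ?mulr_ge0 ?ltW//.
    by rewrite -addn1 natrD; lra.
  apply: (cvg_average cN); last exact: cvg_cst.
  rewrite -(mul0r (2 * r * #|` F0|%:R)).
  apply: cvgM; last exact: cvg_cst.
  by rewrite -cvg_shiftS; exact: cvg_harmonic.
- move=> E F r x _ r0 Fr clx.
  have [c [cF cx]] :=
    cvg_average_closure (fun y => @norm_le_of_sub_ball _ _ _ _ y r0 Fr) clx.
  by exists (c \o predn); split=> // n _; exact: cF.
Qed.
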